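(* Let $d\ge 1$ and let $i(x)=\sum_{j=0}^d c_jx^j(x+1)^{d-j}$ with $c_j\ge 0$ for all $0\le j\le d$. Define the polynomial $h$ by $\sum_{m\ge 0} i(m)x^m=\frac{h(x)}{(1-x)^{d+1}}$. If \[c_0+c_1+\cdots+c_j\le c_d+c_{d-1}+\cdots+c_{d-j}\] for all $0\le j\le d/2$, then the $\mathcal{I}_d$-decomposition $(a,b)$ of $h$ is real-rooted, i.e., both $a$ and $b$ are real-rooted.
   Context: For a polynomial $p$ of degree at most $d$, $\mathcal{I}_d(p)(x)=x^dp(1/x)$. Every $p$ of degree at most $d$ can be written uniquely as $p=a+xb$ with $\deg a\le d$, $\deg b\le d-1$, $\mathcal{I}_d(a)=a$ and $\mathcal{I}_{d-1}(b)=b$; the pair $(a,b)$ is the $\mathcal{I}_d$-decomposition of $p$. A polynomial is real-rooted if all its zeros are real or it is identically zero. *)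

(* Defs.v *)
From mathcomp Require Import all_boot all_order all_algebra.
From mathcomp Require Import complex reals ring.

Set Implicit Arguments.
Unset Strict Implicit.
Unset Printing Implicit Defensive.

Import Order.TTheory GRing.Theory Num.Theory.
Local Open Scope ring_scope.

(* x^d * p(1/x), monomial by monomial. It is used only when p has degree at
   most d, i.e. size p <= d.+1; see horner_Iop. *)
Definition Iop (R : nzRingType) (d : nat) (p : {poly R}) : {poly R} :=
  \sum_(i < d.+1) p`_i *: 'X^(d - i).

Definition is_Iop_decomposition (R : nzRingType) (d : nat)
    (p a b : {poly R}) : Prop :=
  [/\ p = a + 'X * b,
      (size a <= d.+1)%N,
      (size b <= d)%N,
      Iop d a = a
    & Iop d.-1 b = b].

(* The zeros are the complex ones, R[i] being the algebraic closure of R. *)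
Definition real_rooted (R : rcfType) (p : {poly R}) : Prop :=
  p = 0 \/
  forall z : R[i], root (map_poly (real_complex R) p) z ->
    exists x : R, z = real_complex R x.

(* Formal power series are represented by their coefficient sequences. *)
Definition fps_mul (R : nzRingType) (f g : nat -> R) (n : nat) : R :=
  \sum_(k < n.+1) f k * g (n - k)%N.

(* \sum_(m >= 0) i(m) x^m = h(x) / (1 - x)^(d+1) as formal power series, with
   the denominator (invertible in R[[x]]) multiplied out. *)
Definition is_series_numerator (R : nzRingType) (d : nat)
    (i h : {poly R}) : Prop :=
  forall n : nat,
    fps_mul (fun k => ((1 - 'X) ^+ d.+1 : {poly R})`_k)
            (fun m => i.[m%:R]) n = h`_n.

Lemma horner_Iop (R : fieldType) (d : nat) (p : {poly R}) (x : R) :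
  (size p <= d.+1)%N -> x != 0 -> (Iop d p).[x] = x ^+ d * p.[x^-1].
Proof.
move=> hp x0; rewrite (horner_coef_wide _ hp) /Iop horner_sum mulr_sumr.
apply: eq_bigr => i _; rewrite hornerZ hornerXn mulrCA; congr (_ * _).
apply: (mulIf (expf_neq0 i x0)).
by rewrite -exprD subnK ?leq_ord // exprVn -mulrA mulVf ?mulr1 ?expf_neq0.
Qed.

Lemma coef_Iop (R : nzRingType) (d : nat) (p : {poly R}) (k : nat) :
  (Iop d p)`_k = if (k <= d)%N then p`_(d - k) else 0.
Proof.
rewrite /Iop (reindex_inj rev_ord_inj) /=.
under eq_bigr => i _ do rewrite subSS subKn ?leq_ord //.
by rewrite -(poly_def d.+1 (fun i => p`_(d - i))) coef_poly ltnS.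
Qed.

Lemma Iop_decomposition_exists_unique (R : idomainType) (d : nat)
    (p : {poly R}) : (0 < d)%N -> (size p <= d.+1)%N ->
  exists! ab : {poly R} * {poly R}, is_Iop_decomposition d p ab.1 ab.2.
Proof.
case: d => // d _ hp.
have IB m (q r : {poly R}) : Iop m (q - r) = Iop m q - Iop m r.
  by apply/polyP=> k; rewrite !(coefB, coef_Iop); case: ifP; rewrite ?subr0.
have IX (q : {poly R}) : Iop d.+1 ('X * q) = Iop d q.
  apply/polyP=> k; rewrite !coef_Iop coefXM.
  case: (ltngtP k d.+1) => [kd|dk|->]; last by rewrite subnn ltnn.
    by rewrite -ltnS kd subSn.
  by rewrite leqNgt (ltn_trans _ dk).
have IS (q : {poly R}) : (size q <= d.+1)%N -> Iop d.+1 q = 'X * Iop d q.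
  move=> hq; apply/polyP=> k; rewrite coefXM !coef_Iop.
  case: k => [|k] /=; first by rewrite subn0 nth_default.
  by rewrite ltnS subSS.
have IK m (q : {poly R}) : (size q <= m.+1)%N -> Iop m (Iop m q) = q.
  move=> hq; apply/polyP=> k; rewrite !coef_Iop leq_subr.
  case: leqP => [km|mk]; first by rewrite subKn.
  by rewrite nth_default // (leq_trans hq).
have sI m (q : {poly R}) : (size (Iop m q) <= m.+1)%N.
  by apply/leq_sizeP => k hk; rewrite coef_Iop leqNgt hk.
have X1 : 'X - 1 != 0 :> {poly R} by rewrite -polyC1 polyXsubC_eq0.
have /factor_theorem[b hb] : root (p - Iop d.+1 p) 1.
  rewrite /root hornerD hornerN (horner_coef_wide _ hp) /Iop horner_sum subr_eq0.
  apply/eqP/eq_bigr => i _.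
  by rewrite hornerZ hornerXn !expr1n.
rewrite polyC1 in hb.
have sb : (size b <= d.+1)%N.
  have [->|b0] := eqVneq b 0; first by rewrite size_poly0.
  have : (size (b * ('X - 1))%R <= d.+2)%N.
    by rewrite -hb (leq_trans (size_polyD _ _)) // geq_max hp size_polyN sI.
  by rewrite size_mul // -polyC1 size_XsubC addn2.
have bI : Iop d b = b.
  apply: (mulIf X1); rewrite -hb.
  have := congr1 (Iop d.+1) hb.
  rewrite IB IK // mulrBr mulr1 IB [b * 'X]mulrC IX (IS b) // => e.
  by rewrite -(opprB (Iop d.+1 p)) e opprB mulrBr mulr1 mulrC.
have aI : Iop d.+1 (p - 'X * b) = p - 'X * b.
  rewrite IB IX bI; apply/eqP; rewrite -subr_eq0.
  have -> : Iop d.+1 p - b - (p - 'X * b) = - (p - Iop d.+1 p) + b * ('X - 1).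
    by ring.
  by rewrite hb addNr.
exists (p - 'X * b, b); split.
  split; rewrite /= ?subrK //; rewrite -aI; exact: sI.
case=> a' b' [/= e sa' sb' ha' hb'].
have e' : p - Iop d.+1 p = b' * ('X - 1).
  have -> : Iop d.+1 p = a' + b'.
    rewrite -[X in _ = X + _]ha' -[X in _ = _ + X]hb' -IX e.
    have := IB d.+1 (a' + 'X * b') ('X * b'); rewrite addrK => ->.
    by rewrite subrK.
  by rewrite e mulrBr mulr1 [b' * 'X]mulrC opprD addrACA subrr add0r.
have <- : b = b' by apply: (mulIf X1); rewrite -hb.
by move: e; rewrite (mulIf X1 (etrans (esym hb) e')) => ->; rewrite addrK.
Qed.

(* Main.v *)
(* Let eul d j be the numerator of the series with coefficients
   m^j (m+1)^(d-j), so that h = \sum_j c_j eul d j. With n = d - 1, one has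
     eul d j = \sum_(k <= n) x^[k < j] eul n k  and  Iop d (eul d j) = eul d (d-j),
   whence, with e_k = c_0 + ... + c_k, the decomposition of h is
     a = \sum_(k <= n) (e_(n-k) x + e_k) eul n k,
     b = \sum_(k <= n) (e_d - e_k - e_(n-k)) eul n k.
   The coefficients of a are nonnegative because the c_j are, those of b because
   of the partial sum inequalities. For z in the open upper half-plane the
   recursion keeps the arguments of eul n 0, ..., eul n n, z * eul n 0 at z
   increasing within a sector of angle arg z < pi, so b(z) = 0 forces b = 0. If
   a(z) = z F + G = 0, the monotonicity of e places arg G between arg F and
   arg F + pi, while G = - z F; so F = G = 0 and a = 0. *)
Require Import Defs.
From mathcomp Require Import all_boot all_order all_algebra.
From mathcomp Require Import complex reals.
From mathcomp Require Import ring zify.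

Set Implicit Arguments.
Unset Strict Implicit.
Unset Printing Implicit Defensive.

Import Order.TTheory GRing.Theory Num.Theory.
Local Open Scope ring_scope.

(** * Planar geometry: [cross u v], the imaginary part of conj(u) v, compares arguments *)

Definition cross (R : rcfType) (u v : R[i]) : R :=
  complex.Re u * complex.Im v - complex.Im u * complex.Re v.

Section Cross.
Variables (R : rcfType).
Implicit Types (u v z : R[i]).

Lemma crossDl u v z : cross (u + v) z = cross u z + cross v z.
Proof. by case: u v z => [? ?] [? ?] [? ?]; rewrite /cross /=; ring. Qed.

Lemma crossDr u v z : cross z (u + v) = cross z u + cross z v.
Proof. by case: u v z => [? ?] [? ?] [? ?]; rewrite /cross /=; ring. Qed.

Lemma cross0l z : cross 0 z = 0.
Proof. by rewrite /cross /= !mul0r subrr. Qed.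

Lemma cross0r z : cross z 0 = 0.
Proof. by rewrite /cross /= !mulr0 subrr. Qed.

Lemma crossvv z : cross z z = 0.
Proof. by rewrite /cross mulrC subrr. Qed.

Lemma crossZl (s : R) u v : cross (real_complex R s * u) v = s * cross u v.
Proof. by case: u v => [? ?] [? ?]; rewrite /cross /=; ring. Qed.

Lemma crossZr (s : R) u v : cross u (real_complex R s * v) = s * cross u v.
Proof. by case: u v => [? ?] [? ?]; rewrite /cross /=; ring. Qed.

Lemma cross_suml I (r : seq I) (P : pred I) (F : I -> R[i]) v :
  cross (\sum_(k <- r | P k) F k) v = \sum_(k <- r | P k) cross (F k) v.
Proof. by elim/big_rec2: _ => [|k x y _ <-]; rewrite ?cross0l ?crossDl. Qed.

Lemma cross_sumr I (r : seq I) (P : pred I) (F : I -> R[i]) v :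
  cross v (\sum_(k <- r | P k) F k) = \sum_(k <- r | P k) cross v (F k).
Proof. by elim/big_rec2: _ => [|k x y _ <-]; rewrite ?cross0r ?crossDr. Qed.

Lemma cross_mulz z u : cross u (z * u) =
  complex.Im z * (complex.Re u ^+ 2 + complex.Im u ^+ 2).
Proof. by case: u z => [? ?] [? ?]; rewrite /cross /=; ring. Qed.

Lemma cross_mulz_gt0 z u : 0 < complex.Im z -> u != 0 -> 0 < cross u (z * u).
Proof.
move=> z0; rewrite cross_mulz; case: u => x y; rewrite eq_complex /= negb_and.
move=> xy; apply: mulr_gt0 => //.
rewrite lt_def addr_ge0 ?sqr_ge0 // andbT paddr_eq0 ?sqr_ge0 //.
by rewrite !sqrf_eq0 negb_and.
Qed.

Lemma cross_mulz_ge0 z u : 0 <= complex.Im z -> 0 <= cross u (z * u).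
Proof. by move=> z0; rewrite cross_mulz mulr_ge0 // addr_ge0 ?sqr_ge0. Qed.

(** By Cramer's rule the two cross products are, up to a common positive factor, the coordinates of
    [u] in the real basis [e], [z * e]. *)
Lemma cross_basis z e u : 0 < complex.Im z -> e != 0 ->
  cross e u = 0 -> cross u (z * e) = 0 -> u = 0.
Proof.
move=> z0 e0 eu uf; have := cross_mulz_gt0 z0 e0.
set f := z * e in uf *; move=> ef.
have Plucker : real_complex R (cross e f) * u =
    real_complex R (cross u f) * e + real_complex R (cross e u) * f.
  apply/eqP; rewrite eq_complex; move: (f) => f'; move: e u f' {eu uf e0 ef f}.
  move=> [? ?] [? ?] [? ?]; rewrite /cross /=.
  by apply/andP; split; apply/eqP; ring.
move: Plucker; rewrite eu uf !rmorph0 !mul0r addr0 => /eqP.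
by rewrite mulf_eq0 (inj_eq (@complexI R) _ 0) gt_eqF //= => /eqP.
Qed.

(* With arguments measured from e, this is the passage from
   0 <= arg u <= arg v <= arg z to arg v <= arg z + arg u. *)
Lemma cross_rotate z e u v : 0 < complex.Im z -> e != 0 ->
  0 <= cross e u -> 0 <= cross u (z * e) ->
  0 <= cross e v -> 0 <= cross v (z * e) ->
  0 <= cross u v -> 0 <= cross v (z * u).
Proof.
move=> z0 e0; have D0 := cross_mulz_gt0 z0 e0.
set s := cross e u; set r := cross u _; set q := cross e v; set p := cross v _.
move=> s0 r0 q0 p0 uv.
(* In the basis [e], [z * e], up to the factor [cross e (z * e)], [u] has coordinates (r, s) and [v]
   has (p, q); [Duv] and [Dvu] are expansions in them. *)
have Duv : cross e (z * e) * cross u v = r * q - s * p.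
  rewrite /s /r /q /p; clear; case: e u v z => [? ?] [? ?] [? ?] [? ?].
  by rewrite /cross /=; ring.
have rq : s * p <= r * q by rewrite -subr_ge0 -Duv mulr_ge0 // ltW.
pose x := complex.Re z; pose y := complex.Im z.
have Dvu : cross e (z * e) * cross v (z * u) =
    p * r + 2 * (p * s) * x + q * s * (x ^+ 2 + y ^+ 2).
  rewrite /s /r /q /p /x /y.
  clear; case: e u v z => [? ?] [? ?] [? ?] [? ?]; rewrite /cross /=; ring.
rewrite -(pmulr_rge0 _ D0) Dvu.
have [q00|qN0] := eqVneq q 0.
  have ps : p * s = 0.
    by apply/eqP; rewrite eq_le mulr_ge0 // andbT mulrC (le_trans rq) // q00 mulr0.
  by rewrite ps q00 mulr0 !mul0r !addr0 mulr_ge0.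
have qp : 0 < q by rewrite lt_def qN0.
rewrite -(pmulr_rge0 _ qp).
(* This is [s] |p + q z|^2, obtained by replacing [r * q] with its lower bound [s * p]. *)
apply: (@le_trans _ _ (s * ((p + q * x) ^+ 2 + (q * y) ^+ 2))).
  by rewrite mulr_ge0 // addr_ge0 ?sqr_ge0.
rewrite -subr_ge0.
have -> : q * (p * r + 2 * (p * s) * x + q * s * (x ^+ 2 + y ^+ 2)) -
  s * ((p + q * x) ^+ 2 + (q * y) ^+ 2) = p * (r * q - s * p) by ring.
by rewrite mulr_ge0 // subr_ge0.
Qed.

(* The arguments of w 0, ..., w d, z * w 0 increase and span at most arg z. *)
Definition interlacing_at z (d : nat) (w : nat -> R[i]) : Prop :=
  (forall k, (k <= d)%N -> w k != 0) /\
  (forall k l, (k <= l <= d)%N ->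
     0 <= cross (w k) (w l) /\ 0 <= cross (w l) (z * w k)).

(** * Vectors ordered by argument inside a sector *)

Section Interlacing.
Variables (z : R[i]) (d : nat) (w : nat -> R[i]).
Hypotheses (z0 : 0 < complex.Im z) (zw : interlacing_at z d w).

(** The vectors lie in the convex sector from [w 0] to [z * w 0]. Crossing the sum with either
    boundary ray gives nonnegative terms of sum zero, so each term vanishes, and [cross_basis]
    applies. *)
Lemma interlacing_sum0 (s : nat -> R) :
  (forall k, (k <= d)%N -> 0 <= s k) ->
  \sum_(k < d.+1) real_complex R (s k) * w k = 0 ->
  forall k, (k <= d)%N -> s k = 0.
Proof.
have [wN0 wI] := zw => s0 sw k kd.
have s0' (j : 'I_d.+1) : 0 <= s j by apply: s0; rewrite -ltnS.
have s1 : \sum_(j < d.+1) s j * cross (w 0%N) (w j) = 0.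
  by under eq_bigr do rewrite -crossZr; rewrite -cross_sumr sw cross0r.
have s2 : \sum_(j < d.+1) s j * cross (w j) (z * w 0%N) = 0.
  by under eq_bigr do rewrite -crossZl; rewrite -cross_suml sw cross0l.
have w0 (j : 'I_d.+1) : (0 <= j <= d)%N by rewrite leq0n /= -ltnS.
pose o : 'I_d.+1 := Ordinal (kd : (k < d.+1)%N).
have /eqP t1 : s o * cross (w 0%N) (w o) = 0.
  apply: (psumr_eq0P _ s1) => // j _.
  by rewrite mulr_ge0 //; have [] := wI 0%N j (w0 j).
have /eqP t2 : s o * cross (w o) (z * w 0%N) = 0.
  apply: (psumr_eq0P _ s2) => // j _.
  by rewrite mulr_ge0 //; have [] := wI 0%N j (w0 j).
apply/eqP; case: eqVneq => // sk.
move: t1 t2; rewrite !mulf_eq0 /= => /orP + /orP.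
rewrite (negbTE sk) => -[//|/eqP c1] [//|/eqP c2].
by have := wN0 k kd; rewrite (cross_basis z0 (wN0 0%N (leq0n d)) c1 c2) eqxx.
Qed.

(** The inequality on 2 by 2 minors shifts [t] towards larger arguments than [s], so [cross F G] is
    nonnegative; but G = - z F would make it negative unless F = 0. *)
Lemma interlacing_linear_sum0 (s t : nat -> R) :
  (forall k, (k <= d)%N -> 0 <= s k) -> (forall k, (k <= d)%N -> 0 <= t k) ->
  (forall k l, (k <= l <= d)%N -> s l * t k <= s k * t l) ->
  \sum_(k < d.+1) (real_complex R (s k) * z + real_complex R (t k)) * w k = 0 ->
  forall k, (k <= d)%N -> s k = 0 /\ t k = 0.
Proof.
move=> s0 t0 st; have [wN0 wI] := zw.
pose F := \sum_(k < d.+1) real_complex R (s k) * w k.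
pose G := \sum_(k < d.+1) real_complex R (t k) * w k.
have -> : \sum_(k < d.+1)
    (real_complex R (s k) * z + real_complex R (t k)) * w k = z * F + G.
  by rewrite mulr_sumr -big_split; apply: eq_bigr => k _ /=; ring.
move=> FG.
have crossFG : 0 <= cross F G.
  rewrite /F /G cross_suml.
  under eq_bigr do rewrite cross_sumr.
  under eq_bigr do under eq_bigr do rewrite crossZl crossZr.
  (* Exchanging the indices in one of two copies pairs (k, l) with (l, k); by antisymmetry a pair
     contributes (s k t l - s l t k) cross (w k) (w l). *)
  set S := (X in 0 <= X); suff: 0 <= S + S by rewrite -mulr2n pmulrn_lge0.
  rewrite {2}/S exchange_big -big_split sumr_ge0 //= => k _.
  rewrite -big_split sumr_ge0 //= => l _.
  have anti u v : cross v u = - cross u v by rewrite /cross; ring.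
  have kd : (k <= d)%N by rewrite -ltnS.
  have ld : (l <= d)%N by rewrite -ltnS.
  have [kl|/ltnW lk] := leqP k l.
    rewrite (anti (w k)).
    have [c0 _] : _ /\ _ := wI k l (introT andP (conj kl ld)).
    have := st k l (introT andP (conj kl ld)).
    rewrite -subr_ge0 => /mulr_ge0 /(_ c0); congr (0 <= _); ring.
  rewrite (anti (w l) (w k)).
  have [c0 _] : _ /\ _ := wI l k (introT andP (conj lk kd)).
  have := st l k (introT andP (conj lk kd)).
  rewrite -subr_ge0 => /mulr_ge0 /(_ c0); congr (0 <= _); ring.
have F0 : F = 0.
  apply/eqP; apply: contraLR crossFG => FN0; rewrite -ltNge.
  have -> : G = - (z * F) by apply/eqP; rewrite -addr_eq0 addrC FG.
  have -> : cross F (- (z * F)) = - cross F (z * F).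
    by rewrite /cross !raddfN /=; ring.
  by rewrite oppr_lt0 cross_mulz_gt0.
have G0 : G = 0 by rewrite -FG F0 mulr0 add0r.
by move=> k kd; split; apply: interlacing_sum0 kd.
Qed.

(** Going from [w' j] to [w' l] turns one block of vectors by [z], which only increases the
    argument. The last sum is [z] times the first, so the new family closes up in a sector of the
    same angle. *)
Lemma interlacing_step :
  interlacing_at z d.+1 (fun j => \sum_(k < d.+1) z ^+ (k < j)%N * w k).
Proof.
have [wN0 wI] := zw; set w' := (fun j => _).
have w'N0 j : (j <= d.+1)%N -> w' j != 0.
  move=> jd; apply/eqP => w'j.
  (* With these indicators [w' j] has the form of [interlacing_linear_sum0]; they cannot both vanish
     at 0. *)
  pose s k : R := (k < j)%N%:R; pose t k : R := (j <= k)%N%:R.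
  have [] : s 0%N = 0 /\ t 0%N = 0.
    apply: interlacing_linear_sum0 (leq0n d).
    - by move=> k _; rewrite ler0n.
    - by move=> k _; rewrite ler0n.
    - move=> k l /andP[kl _]; rewrite /s /t -!natrM ler_nat.
      by case: (ltnP l j); case: (ltnP k j) => //=; lia.
    - rewrite -[RHS]w'j; apply: eq_bigr => k _; congr (_ * _).
      rewrite /s /t; case: ltnP => _ /=.
        by rewrite rmorph1 rmorph0 mul1r addr0 expr1.
      by rewrite rmorph1 rmorph0 mul0r add0r expr0.
  by rewrite /s /t; case: (j) => [|?] /eqP + /eqP; rewrite /= oner_eq0.
have sum_ge0 (P Q : pred nat) (f : R[i] -> R[i]) :
    {morph f : x y / x + y} -> f 0 = 0 ->
    (forall k l, (k <= d)%N -> (l <= d)%N -> P k -> Q l ->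
      0 <= cross (w k) (f (w l))) ->
    0 <= cross (\sum_(k < d.+1 | P k) w k) (f (\sum_(l < d.+1 | Q l) w l)).
  move=> fD f0 PQ; rewrite (big_morph f fD f0) cross_suml sumr_ge0 // => k Pk.
  rewrite cross_sumr sumr_ge0 // => l Ql.
  by apply: PQ; rewrite // -ltnS.
have w'I j l : (j <= l <= d.+1)%N -> 0 <= cross (w' j) (w' l).
  move=> /andP[jl ld].
  (* [A] is turned by [z] in both sums, [B] only in [w' l], and [C] in neither. *)
  pose A := \sum_(k < d.+1 | (k < j)%N) w k.
  pose B := \sum_(k < d.+1 | (j <= k < l)%N) w k.
  pose C := \sum_(k < d.+1 | (l <= k)%N) w k.
  have w'E m : w' m = z * (\sum_(k < d.+1 | (k < m)%N) w k) +
                      \sum_(k < d.+1 | (m <= k)%N) w k.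
    rewrite /w' (bigID (fun k : 'I__ => (k < m)%N)) /= mulr_sumr; congr (_ + _).
      by apply: eq_bigr => k ->; rewrite expr1.
    by apply: eq_big => k; rewrite -leqNgt // ltnNge => ->; rewrite mul1r.
  have -> : w' j = z * A + (B + C).
    rewrite w'E; congr (_ + _); rewrite (bigID (fun k : 'I__ => (k < l)%N)) /=.
    by congr (_ + _); apply: eq_bigl => k; lia.
  have -> : w' l = z * A + (z * B + C).
    rewrite w'E addrA -mulrDr; congr (_ * _ + _).
    rewrite (bigID (fun k : 'I__ => (k < j)%N)) /=.
    by congr (_ + _); apply: eq_bigl => k; lia.
  have -> : cross (z * A + (B + C)) (z * A + (z * B + C)) =
      (complex.Re z ^+ 2 + complex.Im z ^+ 2) * cross A B + cross B (z * A) +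
      cross B (z * B) + cross C (z * B) + cross B C.
    move: (A) (B) (C) => [? ?] [? ?] [? ?]; case: (z) => [? ?].
    by rewrite /cross /=; ring.
  have mz : {morph *%R z : x y / x + y} by move=> x y; rewrite mulrDr.
  have AB : 0 <= cross A B.
    apply: (sum_ge0 (fun k => (k < j)%N) (fun k => (j <= k < l)%N) id) => //.
    by move=> k m kd md kj jml; have [] := wI k m; [lia|].
  have BC : 0 <= cross B C.
    apply: (sum_ge0 (fun k => (j <= k < l)%N) (fun k => (l <= k)%N) id) => //.
    by move=> k m kd md kj jml; have [] := wI k m; [lia|].
  have BA : 0 <= cross B (z * A).
    apply: (sum_ge0 (fun k => (j <= k < l)%N) (fun k => (k < j)%N) ( *%R z)).
    - exact: mz.
    - exact: mulr0.
    - by move=> k m kd md kj jml; have [] := wI m k; [lia|].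
  have CB : 0 <= cross C (z * B).
    apply: (sum_ge0 (fun k => (l <= k)%N) (fun k => (j <= k < l)%N) ( *%R z)).
    - exact: mz.
    - exact: mulr0.
    - by move=> k m kd md kj jml; have [] := wI m k; [lia|].
  have BB : 0 <= cross B (z * B) by rewrite cross_mulz_ge0 // ltW.
  do 4![apply: addr_ge0 => //].
  by rewrite mulr_ge0 // addr_ge0 ?sqr_ge0.
(* This converts [w'I] at index [d.+1] into the bounds against [z * w' 0] that [cross_rotate]
   needs. *)
have w'top : w' d.+1 = z * w' 0%N.
  by rewrite /w' mulr_sumr; apply: eq_bigr => k _; rewrite ltn_ord expr1 mul1r.
split=> // k l /andP[kl ld]; split; first by apply: w'I; rewrite kl.
have kd := leq_trans kl ld.
apply: (cross_rotate (e := w' 0%N)); rewrite -?w'top // ?w'N0 ?w'I ?leqnn ?kd ?ld ?kl //.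
Qed.

End Interlacing.
End Cross.

(** * Real-rootedness via the upper half-plane, and the refined Eulerian polynomials *)

Lemma real_rooted_upper (R : rcfType) (p : {poly R}) :
  (forall z : R[i], 0 < complex.Im z ->
     root (map_poly (real_complex R) p) z -> p = 0) ->
  real_rooted p.
Proof.
move=> pU; have [->|pN0] := eqVneq p 0; first by left.
right=> z pz; exists (complex.Re z); case: z pz => x y pz.
suff -> : y = 0 by [].
have [y0|y0|//] := ltgtP y 0; last by move/eqP: pN0; case; exact: pU pz.
(* In the lower half-plane, pass to the conjugate zero: the coefficients are real. *)
have pz' : root (map_poly (real_complex R) p) (Complex x (- y)).
  rewrite -[Complex x _]/(complex.conjc (Complex x y)) -complex_root_conj.
  rewrite -map_poly_comp; congr (root _ _): pz; apply: eq_map_poly => t.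
  exact/esym/conjc_real.
by move/eqP: pN0; case; apply: pU pz'; rewrite /= oppr_gt0.
Qed.

(* eul d j is the descent enumerator of the permutations of d.+1 letters
   starting with the letter j (counted from 0). *)
Fixpoint eul (R : nzRingType) (d j : nat) : {poly R} :=
  if d is d'.+1 then \sum_(k < d'.+1) 'X^(k < j)%N * eul R d' k else 1.

Lemma eul_interlacing (R : rcfType) (z : R[i]) (d : nat) : 0 < complex.Im z ->
  interlacing_at z d (fun k => (map_poly (real_complex R) (eul R d k)).[z]).
Proof.
move=> z0; elim: d => [|d IHd] /=.
  rewrite rmorph1 hornerC; split=> [k _|k l _]; first exact: oner_neq0.
  by rewrite crossvv lexx cross_mulz_ge0 // ltW.
have [N0 I] := interlacing_step z0 IHd.
have E j : (map_poly (real_complex R)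
      (\sum_(k < d.+1) 'X^(k < j)%N * eul R d k)).[z] =
    \sum_(k < d.+1) z ^+ (k < j)%N * (map_poly (real_complex R) (eul R d k)).[z].
  rewrite rmorph_sum horner_sum; apply: eq_bigr => k _.
  by rewrite rmorphM /= map_polyXn hornerM hornerXn.
by split=> [k kd|k l kl]; rewrite !E; [exact: N0|exact: I].
Qed.

(** * The reversal operator on refined Eulerian polynomials *)

Section IopTheory.
Variables (R : nzRingType).
Implicit Types (p q : {poly R}) (d : nat).

Lemma Iop0 d : Iop d 0 = 0 :> {poly R}.
Proof. by apply/polyP=> k; rewrite coef_Iop !coef0 if_same. Qed.

Lemma IopD d p q : Iop d (p + q) = Iop d p + Iop d q.
Proof.
by apply/polyP=> k; rewrite !(coefD, coef_Iop); case: ifP; rewrite ?addr0.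
Qed.

Lemma IopZ d (s : R) p : Iop d (s *: p) = s *: Iop d p.
Proof.
by apply/polyP=> k; rewrite !(coefZ, coef_Iop); case: ifP; rewrite ?mulr0.
Qed.

Lemma Iop_sum d I (r : seq I) (P : pred I) (F : I -> {poly R}) :
  Iop d (\sum_(k <- r | P k) F k) = \sum_(k <- r | P k) Iop d (F k).
Proof. by elim/big_rec2: _ => [|k x y _ <-]; rewrite ?Iop0 ?IopD. Qed.

Lemma size_Iop d p : (size (Iop d p) <= d.+1)%N.
Proof. by apply/leq_sizeP => k dk; rewrite coef_Iop leqNgt dk. Qed.

Lemma Iop_mulX d p : Iop d.+1 ('X * p) = Iop d p.
Proof.
apply/polyP=> k; rewrite !coef_Iop coefXM; case: (ltngtP k d.+1) => [kd|dk|->].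
- by rewrite -ltnS kd subSn.
- by rewrite leqNgt (ltn_trans _ dk).
- by rewrite subnn ltnn.
Qed.

Lemma IopS d p : (size p <= d.+1)%N -> Iop d.+1 p = 'X * Iop d p.
Proof.
move=> sp; apply/polyP=> -[|k]; rewrite coefXM !coef_Iop /= ?subSS //.
by rewrite subn0 nth_default.
Qed.

(** Raising the reversal degree by one removes a factor ['X] where there was one and adds it where
    there was none; reindexing k to d - k matches this with the complementary index set. *)
Lemma Iop_eul d j : (j <= d)%N -> Iop d (eul R d j) = eul R d (d - j).
Proof.
elim: d j => [|d IHd] j jd.
  by apply/polyP=> k; rewrite coef_Iop /= !coef1; case: k.
rewrite /= Iop_sum [RHS](reindex_inj rev_ord_inj) /=; apply: eq_bigr => k _.
have kd : (k <= d)%N by rewrite -ltnS.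
(* By induction [eul R d k] is itself a reversal, which bounds its size. *)
have sk : (size (eul R d k) <= d.+1)%N.
  by rewrite -(subKn kd) -IHd ?leq_subr // size_Iop.
rewrite subSS; case: ltnP => kj.
  by rewrite expr1 Iop_mulX IHd // (_ : (_ < _)%N = false) ?mul1r //; lia.
by rewrite mul1r IopS // IHd // (_ : (_ < _)%N = true) //; lia.
Qed.

Lemma size_eul d j : (j <= d)%N -> (size (eul R d j) <= d.+1)%N.
Proof. by move=> jd; rewrite -(subKn jd) -Iop_eul ?leq_subr // size_Iop. Qed.

End IopTheory.

(** * Numerators of the series of polynomial values *)

Section Numerators.
Variable R : comNzRingType.
Implicit Types (p q : {poly R}) (f g : nat -> R).

Lemma fps_mul_1subX q f n :
  fps_mul (fun k => ((1 - 'X) * q)`_k) f n =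
  fps_mul (fun k => q`_k) f n -
  (if n is m.+1 then fps_mul (fun k => q`_k) f m else 0).
Proof.
rewrite /fps_mul; under eq_bigr do
  rewrite mulrBl mul1r coefB coefXM mulrBl.
rewrite sumrB; congr (_ - _).
rewrite big_ord_recl /= mul0r add0r.
case: n => [|n]; first by rewrite big_ord0.
by apply: eq_bigr => k _; rewrite /= /bump add1n subSS.
Qed.

(** A series without constant term is x times its shift. *)
Lemma fps_mul_shift q f n : f 0%N = 0 ->
  fps_mul (fun k => q`_k) f n.+1 = fps_mul (fun k => q`_k) (fun m => f m.+1) n.
Proof.
move=> f0; rewrite /fps_mul big_ord_recr /= subnn f0 mulr0 addr0.
by apply: eq_bigr => k _; rewrite subSn // -ltnS.
Qed.

(** A coefficient sequence, so that no polynomial numerator has to be exhibited first. *)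
Definition numer d p n :=
  fps_mul (fun k => ((1 - 'X) ^+ d.+1 : {poly R})`_k) (fun m => p.[m%:R]) n.

Lemma numerD d p q n : numer d (p + q) n = numer d p n + numer d q n.
Proof.
rewrite /numer /fps_mul -big_split; apply: eq_bigr => k _ /=.
by rewrite hornerD mulrDr.
Qed.

Lemma numerZ d (s : R) p n : numer d (s *: p) n = s * numer d p n.
Proof.
rewrite /numer /fps_mul mulr_sumr; apply: eq_bigr => k _ /=.
by rewrite hornerZ mulrCA.
Qed.

Lemma numer_sum d I (r : seq I) (P : pred I) (F : I -> {poly R}) n :
  numer d (\sum_(k <- r | P k) F k) n = \sum_(k <- r | P k) numer d (F k) n.
Proof.
elim/big_rec2: _ => [|k x y _ <-]; last by rewrite numerD.
by rewrite -(scale0r 0) numerZ mul0r.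
Qed.

Lemma numer_eul d j n : (j <= d)%N ->
  numer d ('X^j * ('X + 1) ^+ (d - j)) n = (eul R d j)`_n.
Proof.
elim: d j n => [|d IHd] j n.
  rewrite leqn0 => /eqP->; rewrite mul1r expr0 coef1 /numer /fps_mul expr1.
  under eq_bigr do rewrite hornerC mulr1 coefB coef1 coefX.
  case: n => [|n]; first by rewrite big_ord1 subr0.
  rewrite big_ord_recl big_ord_recl big1 /= ?addr0 ?subr0 ?sub0r ?subrr //.
pose T j := numer d.+1 ('X^j * ('X + 1) ^+ (d.+1 - j)).
pose S := \sum_(k < d.+1) eul R d k.
pose A j := \sum_(k < d.+1 | (k < j)%N) eul R d k.
(* Consecutive products differ by x^i (x+1)^(d-i), of degree [d], whose numerator picks up one extra
   factor 1 - x. *)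
have TS i m : (i <= d)%N -> T i.+1 m = T i m + (('X - 1) * eul R d i)`_m.
  move=> id; apply/eqP; rewrite addrC -subr_eq; apply/eqP; rewrite /T subSS subSn //.
  have -> : 'X^(i.+1) * ('X + 1) ^+ (d - i) = 'X^i * ('X + 1) ^+ (d - i).+1 -
      'X^i * ('X + 1) ^+ (d - i) :> {poly R} by rewrite !exprS; ring.
  rewrite -scaleN1r numerD numerZ addrAC subrr add0r mulN1r.
  rewrite /numer exprS fps_mul_1subX -/(numer _ _ _) IHd //.
  rewrite mulrBl mul1r coefB coefXM.
  case: m => [|m]; first by rewrite subr0 sub0r.
  by rewrite -/(numer _ _ _) IHd // opprB.
have TA i m : (i <= d.+1)%N -> T i m = T 0%N m + (('X - 1) * A i)`_m.
  elim: i => [|i IHi] id; first by rewrite /A big_pred0_eq mulr0 coef0 addr0.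
  rewrite TS // IHi 1?ltnW // -addrA -coefD -mulrDr; congr (_ + (polyseq _)`_m); congr (_ * _).
  rewrite /A [RHS](bigD1 (Ordinal id)) //= addrC; congr (_ + _).
  by apply: eq_bigl => k; rewrite ltnS -val_eqE /= [RHS]andbC ltn_neqAle.
(* The values m^(d+1) are those of (m+1)^(d+1) shifted by one, so [T d.+1] is x times [T 0]. With
   [TA] this gives (x - 1) [T 0] = (x - 1) [S], solved coefficient by coefficient. *)
have Tn0 m : T 0%N m = S`_m.
  have Ttop := TA _ _ (leqnn d.+1).
  have AS : A d.+1 = S by apply: eq_bigl => k; rewrite ltn_ord.
  elim: m => [|m IHm].
    have : T d.+1 0%N = 0.
      by rewrite /T /numer /fps_mul big_ord1 hornerM hornerXn expr0n mul0r mulr0.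
    rewrite Ttop AS mulrBl mul1r coefB coefXM sub0r => /eqP.
    by rewrite subr_eq0 => /eqP.
  have : T d.+1 m.+1 = T 0%N m.
    rewrite /T /numer fps_mul_shift; last first.
      by rewrite hornerM hornerXn expr0n mul0r.
    apply: eq_bigr => k _; congr (_ * _).
    rewrite subnn expr0 mulr1 mul1r subn0 hornerXn horner_exp.
    by rewrite hornerD hornerX hornerC -natr1.
  rewrite Ttop AS IHm mulrBl mul1r coefB coefXM /= addrCA => /eqP.
  by rewrite -[X in _ == X]addr0 (inj_eq (addrI _)) subr_eq0 => /eqP.
move=> jd; transitivity (T j n) => //; rewrite TA // Tn0 -coefD; congr (polyseq _)`_n => /=.
(* Adding (x - 1) [A j] to [S] puts a factor x exactly on the terms with k < j. *)
rewrite /S /A mulr_sumr (bigID (fun k : 'I__ => (k < j)%N)) /= addrAC.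
rewrite [RHS](bigID (fun k : 'I__ => (k < j)%N)) /= -big_split.
congr (_ + _); apply: eq_bigr => k.
  by move=> -> /=; rewrite expr1; ring.
by move=> /negbTE -> /=; rewrite mul1r.
Qed.

End Numerators.

(** * Combinations of Eulerian polynomials and the decomposition of [h] *)

Lemma real_rooted_eul_sum (R : rcfType) (d : nat) (s t : nat -> R) :
  (forall k, (k <= d)%N -> 0 <= s k) -> (forall k, (k <= d)%N -> 0 <= t k) ->
  (forall k l, (k <= l <= d)%N -> s l * t k <= s k * t l) ->
  real_rooted (\sum_(k < d.+1) (s k *: 'X + (t k)%:P) * eul R d k).
Proof.
move=> s0 t0 st; apply: real_rooted_upper => z z0 /eqP pz.
(* A zero in the upper half-plane forces all coefficients to vanish. *)
have st0 := interlacing_linear_sum0 z0 (eul_interlacing d z0) s0 t0 st.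
apply: big1 => k _; have kd : (k <= d)%N by rewrite -ltnS.
have [|-> ->] := st0 _ k kd; last by rewrite scale0r addr0 mul0r.
rewrite -[RHS]pz rmorph_sum horner_sum; apply: eq_bigr => j _.
by rewrite rmorphM /= rmorphD /= map_polyZ map_polyC map_polyX !hornerE.
Qed.

(** The exchange of [s] and [t] agrees with k going to n - k in the coefficients of [a'] below,
    which makes [a'] symmetric. *)
Lemma Iop_eul_linear (R : nzRingType) (n k : nat) (s t : R) : (k <= n)%N ->
  Iop n.+1 ((s *: 'X + t%:P) * eul R n k) =
  (t *: 'X + s%:P) * eul R n (n - k).
Proof.
move=> kn; rewrite !mulrDl -!scalerAl !mul_polyC IopD !IopZ.
by rewrite Iop_mulX IopS ?size_eul // Iop_eul // addrC.
Qed.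

Unset Implicit Arguments.

Theorem theorem2p16 (R : realType) (d : nat) (c : nat -> R)
    (i h a b : {poly R})
    (hd : (1 <= d)%N)
    (hc : forall j : nat, (j <= d)%N -> 0 <= c j)
    (hi : i = \sum_(j < d.+1) c j *: ('X^j * ('X + 1) ^+ (d - j)))
    (hh : is_series_numerator d i h)
    (hle : forall j : nat, (j.*2 <= d)%N ->
       \sum_(k < j.+1) c k <= \sum_(k < j.+1) c (d - k)%N)
    (hab : is_Iop_decomposition d h a b) :
  real_rooted a /\ real_rooted b.
Proof.
case: d hd hc hi hh hle hab => // n _ hc hi hh hle hab.
pose e k := \sum_(j < k.+1) c j; pose E := e n.+1.
pose a' := \sum_(k < n.+1) (e (n - k)%N *: 'X + (e k)%:P) * eul R n k.
pose s k := E - e k - e (n - k)%N.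
(* The zero term gives [b'] the shape required by [real_rooted_eul_sum]. *)
pose b' := \sum_(k < n.+1) (0 *: 'X + (s k)%:P) * eul R n k.
have e0 k : (k <= n.+1)%N -> 0 <= e k.
  move=> kn; apply: sumr_ge0 => j _; apply: hc.
  by rewrite (leq_trans _ kn) // -ltnS.
have eD k : e k.+1 = e k + c k.+1 by rewrite /e big_ord_recr.
have e_le k l : (k <= l <= n.+1)%N -> e k <= e l.
  case/andP=> kl; rewrite -(subnKC kl); elim: (l - k)%N => [|m IHm].
    by rewrite addn0.
  by rewrite addnS => km; rewrite eD ler_wpDr ?hc // IHm // ltnW.
have hE : h = \sum_(j < n.+2) c j *: eul R n.+1 j.
  apply/polyP=> m; rewrite -hh -/(numer n.+1 i m) hi numer_sum coef_sum.
  by apply: eq_bigr => j _; rewrite numerZ coefZ numer_eul // -ltnS.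
(* Unfolding the recursion, [eul R n k] collects [c j] with a factor x for j > k, and without it for
   j <= k. *)
have hE' : h = \sum_(k < n.+1) ((E - e k) *: 'X + (e k)%:P) * eul R n k.
  rewrite hE; under eq_bigr do rewrite /= scaler_sumr.
  rewrite exchange_big; apply: eq_bigr => k _ /=.
  have kn : (k.+1 <= n.+2)%N by rewrite ltnW // ltnS.
  have eE : e k = \sum_(j < n.+2 | (j <= k)%N) c j.
    by rewrite /e (big_ord_widen _ c kn).
  have EE : E - e k = \sum_(j < n.+2 | (k < j)%N) c j.
    apply/eqP; rewrite subr_eq addrC eE; apply/eqP.
    rewrite /E /e (bigID (fun j : 'I_n.+2 => (j <= k)%N)) /=; congr (_ + _).
    by apply: eq_bigl => j; rewrite ltnNge.
  rewrite (bigID (fun j : 'I_n.+2 => (j <= k)%N)) /= addrC mulrDl EE eE.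
  rewrite -scalerAl mul_polyC !scaler_suml; congr (_ + _).
    by apply: eq_big => j; rewrite -ltnNge // => ->.
  by apply: eq_bigr => j jk; rewrite ltnNge jk mul1r.
have Ia : Iop n.+1 a' = a'.
  rewrite Iop_sum [RHS](reindex_inj rev_ord_inj) /=; apply: eq_bigr => k _.
  by rewrite Iop_eul_linear ?subSS ?subKn // -ltnS.
have Ib : Iop n b' = b'.
  rewrite Iop_sum [RHS](reindex_inj rev_ord_inj) /=; apply: eq_bigr => k _.
  have kn : (k <= n)%N by rewrite -ltnS.
  rewrite !scale0r !add0r !mul_polyC IopZ Iop_eul // subSS /s subKn //.
  by rewrite addrAC.
have hab' : is_Iop_decomposition n.+1 h a' b'.
  split=> //; [|by rewrite -Ia size_Iop|by rewrite -Ib size_Iop].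
  rewrite hE' /a' /b' mulr_sumr -big_split; apply: eq_bigr => k _ /=.
  rewrite scale0r add0r mulrA -mulrDl; congr (_ * _).
  rewrite /s -!mul_polyC !rmorphB /=; ring.
have sh : (size h <= n.+2)%N.
  have [-> sa sb _ _] := hab; rewrite (leq_trans (size_polyD _ _)) // geq_max sa.
  by rewrite (leq_trans (size_polyMleq _ _)) // size_polyX.
(* Uniqueness identifies the given pair with the explicit one. *)
have [ab0 [_ u]] := @Iop_decomposition_exists_unique _ n.+1 h isT sh.
have ab := etrans (esym (u (a, b) hab)) (u (a', b') hab').
have [-> ->] : a = a' /\ b = b' by case: ab.
split; [apply: (@real_rooted_eul_sum _ _ (fun k => e (n - k)%N) e)
       |apply: (@real_rooted_eul_sum _ _ (fun=> 0) s)]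
  => // [k kn|k kn|k l /andP[kl ln]|k kn|k l _].
- by rewrite e0 // (leq_trans (leq_subr _ _)).
- by rewrite e0 // ltnW.
(* For k <= l, monotonicity gives e (n-l) <= e (n-k) and e k <= e l. *)
- apply: ler_pM; rewrite ?e0 ?e_le //; lia.
(* [s] is invariant under k to n - k, which reduces to the range covered by [hle]. *)
- wlog kk : k kn / (k.*2 <= n)%N.
    move=> H; have [|nk] := leqP k.*2 n; first exact: H.
    have := H (n - k)%N; rewrite /s subKn // addrAC; apply; lia.
  (* [E - e (n - k)] is the sum of the last k + 1 coefficients, so nonnegativity of [s k] is [hle]
     at [k]. *)
  have -> : s k = \sum_(j < k.+1) c (n.+1 - j)%N - e k.
    suff EE : E = e (n - k)%N + \sum_(j < k.+1) c (n.+1 - j)%N.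
      by rewrite /s EE; ring.
    rewrite /E /e -!(big_mkord xpredT c).
    rewrite (@big_cat_nat _ _ _ (n - k).+1) //=; last by lia.
    congr (_ + _); rewrite -(big_mkord xpredT (fun j => c (n.+1 - j)%N)).
    rewrite big_nat_rev -[X in \sum_(X <= _ < _) _]add0n big_addn /=.
    have -> : (n.+2 - (n - k).+1 = k.+1)%N by lia.
    by apply: eq_big_nat => j /andP[_ jk]; congr c; lia.
  by rewrite subr_ge0 hle // leqW.
- by rewrite !mul0r.
Qed.
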